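(* Let $X$ be a Peano continuum having a free arc. If there exists a sensitive commutative subsemigroup $F$ of $C^0(X)$ consisting of continuous open maps $X\to X$, then $X$ is an arc or $X$ is a circle.
   Context: A continuum is a compact connected metric space; a Peano continuum is a locally connected continuum. An arc is a continuum homeomorphic to $[0,1]$; a circle is a continuum homeomorphic to the unit circle $\mathbb S^1$ in the complex plane. A free open interval of a metric space $X$ is a subset $J\subset X$ that is open in $X$ and homeomorphic to $(0,1)$. If the closure $\overline J$ in $X$ of a free open interval $J$ is homeomorphic to $[0,1]$, then $\overline J$ is called a free arc of $X$. For a compact metric space $X$ with metric $d$, $C^0(X)$ is the semigroup, under composition, of all continuous maps $X\to X$. A map $f:X\to X$ is open if $f(U)$ is open in $X$ for every open $U\subset X$. A subsemigroup $F\subset C^0(X)$ is sensitive if there is a constant $c>0$ such that for every nonempty open set $U\subset X$ there is some $f\in F$ with $\mathrm{diam}(f(U))>c$, where $\mathrm{diam}(A)=\sup\{d(a,b):a,b\in A\}$. *)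

(* Defs.v *)
From HB Require Import structures.
From mathcomp Require Import all_boot all_order all_algebra.
From mathcomp Require Import all_classical all_reals all_analysis.
From mathcomp Require Import complex.

Set Implicit Arguments.
Unset Strict Implicit.
Unset Printing Implicit Defensive.

Import Order.TTheory GRing.Theory Num.Theory.
Import numFieldTopology.Exports numFieldNormedType.Exports.

Local Open Scope classical_set_scope.
Local Open Scope ring_scope.
Local Open Scope complex_scope.

(* Subsets are compared through [set_type A], which carries the topology
   induced by the ambient space. *)
Definition homeomorphic (T U : topologicalType) : Prop :=
  exists (f : T -> U) (g : U -> T),
    [/\ continuous f, continuous g, cancel f g & cancel g f].

Definition unit_interval (R : realType) : set R := `[0, 1]%classic.

Definition open_unit_interval (R : realType) : set R := `]0, 1[%classic.

(* [R[i]^o] is the complex plane with the topology of its modulus. *)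
Definition unit_circle (R : realType) : set (R[i]^o) := [set z | `|z| = 1].

Definition locally_connected (T : topologicalType) : Prop :=
  forall (x : T) (U : set T), nbhs x U ->
    exists V : set T, [/\ open V, connected V, V x & V `<=` U].

Section continua.
Variables (R : realType) (X : metricType R).

Definition continuum : Prop := compact [set: X] /\ connected [set: X].

Definition peano_continuum : Prop := continuum /\ locally_connected X.

Definition is_arc : Prop :=
  continuum /\ homeomorphic X (set_type (@unit_interval R)).

Definition is_circle : Prop :=
  continuum /\ homeomorphic X (set_type (@unit_circle R)).

Definition free_open_interval (J : set X) : Prop :=
  open J /\ homeomorphic (set_type J) (set_type (@open_unit_interval R)).

Definition free_arc (A : set X) : Prop :=
  exists J : set X, [/\ free_open_interval J, A = closure J
    & homeomorphic (set_type A) (set_type (@unit_interval R))].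

(* Valued in the extended reals so that no boundedness side condition is
   needed; for a nonempty subset of a compact space it is a real number. *)
Definition diam (A : set X) : \bar R :=
  ereal_sup [set (mdist p.1 p.2)%:E | p in A `*` A].

Definition C0 : set (X -> X) := [set f | continuous f].

Definition subsemigroup_C0 (F : set (X -> X)) : Prop :=
  F `<=` C0 /\ (forall f g, F f -> F g -> F (f \o g)).

Definition commutative_maps (F : set (X -> X)) : Prop :=
  forall f g, F f -> F g -> f \o g = g \o f.

Definition open_map (f : X -> X) : Prop :=
  forall U : set X, open U -> open (f @` U).

Definition sensitive (F : set (X -> X)) : Prop :=
  exists2 c : R, 0 < c &
    forall U : set X, open U -> U !=set0 ->
      exists2 f, F f & (c%:E < diam (f @` U))%E.

End continua.

(* Main.v *)
(* Call a path open if it maps open sets of parameters to open sets. Along an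
   open path whose initial point is not visited again, the first visits form an
   initial segment of the parameters; so, near a parameter where the path is not
   locally injective, it runs into an end point of an interval and turns back
   there (a fold). In a connected compact space an open path with two folds covers
   an arc that is open and closed, and a loop without folds covers a circle that is
   open and closed.

   Sensitivity and local connectedness provide a finite family of connected open
   sets such that every open path, in particular every subpath of the free arc,
   is mapped by some element of F across one of them. Minimizing over open paths
   gives an open path g and an open set V swept by g such that each subpath of g
   is mapped across V by an element of F. In particular some h in F expands a subpath:
   it has a fixed point g p and moves nearby points. Taking k in F with
   k (g v0) = g p for a point g v0 moved by h, commutativity gives
   k (h (g v0)) = h (g p) = k (g v0), so k o g has a loop, hence, unless X is a circle,
   a fold. If q in F maps a subpath away from the fold over the
   folded point, then k o q o g = q o k o g has two folds, and X is an arc. *)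

Require Import Defs.
From mathcomp Require Import all_boot all_order all_algebra.
From mathcomp Require Import all_classical all_reals all_analysis.
From mathcomp Require Import complex lra.

Set Implicit Arguments.
Unset Strict Implicit.
Unset Printing Implicit Defensive.

Import Order.TTheory GRing.Theory Num.Theory.
Import numFieldTopology.Exports numFieldNormedType.Exports.

Local Open Scope classical_set_scope.
Local Open Scope ring_scope.

Ltac lin :=
  repeat match goal with H : ?T |- _ =>
    lazymatch type of T with
    | Prop => lazymatch T with
      | is_true _ => fail
      | @eq ?A _ _ =>
        tryif (match goal with F : realType |- _ => unify A (Real.sort F) end)
        then fail else clear H
      | _ => clear H
      end
    | _ => fail
    end
  end; lra.

(** * Open paths and their elementary properties *)

Section open_paths.
Context {R : realType} {X : topologicalType}.
Hypothesis hausX : hausdorff_space X.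
Implicit Types (g : R -> X) (a b s t u v : R).

(** Both conditions concern only the open interval, so [g] can be a total function whose values
    elsewhere do not matter. *)
Definition open_path g a b : Prop :=
  (forall t, a < t < b -> {for t, continuous g}) /\
  (forall U : set R, open U -> U `<=` `]a, b[ -> open (g @` U)).

(** For an open path, the parameters where this fails are the folds. *)
Definition locally_injective_at g c : Prop :=
  exists2 e : R, 0 < e &
    forall s t, c - e < s < c + e -> c - e < t < c + e -> g s = g t -> s = t.

Lemma open_path_sub g a b a' b' : a <= a' -> b' <= b ->
  open_path g a b -> open_path g a' b'.
Proof.
move=> aa' bb' [gC gO]; split=> [t /andP[a't tb']|U oU Uab].
  by apply: gC; rewrite (le_lt_trans aa')// (lt_le_trans tb').
apply: gO => // x /Uab /=; rewrite !in_itv/= => /andP[a'x xb'].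
by rewrite (le_lt_trans aa')// (lt_le_trans xb').
Qed.

Lemma open_path_itv g a b s t : open_path g a b -> a <= s -> t <= b ->
  open (g @` `]s, t[).
Proof.
move=> gp as_ tb; by case: (open_path_sub as_ tb gp) => _; apply => //; exact: itv_open.
Qed.

Lemma open_path_within g a b s t : open_path g a b -> a < s -> t < b ->
  {within `[s, t], continuous g}.
Proof.
move=> [gC _] as_ tb; apply: continuous_in_subspaceT => x.
rewrite inE/= in_itv/= => /andP[sx xt].
by apply: gC; rewrite (lt_le_trans as_ sx) (le_lt_trans xt tb).
Qed.

Lemma open_path_closed g a b s t : open_path g a b -> a < s -> t < b ->
  closed (g @` `[s, t]).
Proof.
move=> gp as_ tb; apply: compact_closed => //.
apply: continuous_compact; last exact: segment_compact.
exact: (open_path_within gp).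
Qed.

Lemma open_path_near g a b t (O : set X) : open_path g a b -> a < t < b ->
  open O -> O (g t) ->
  exists2 e : R, 0 < e & forall s, t - e < s < t + e -> a < s < b /\ O (g s).
Proof.
move=> [gC _] tab oO Ot.
have : \forall s \near t, a < s < b /\ O (g s).
  near=> s; split.
    near: s; have : open (`]a, b[%classic : set R) by exact: itv_open.
    by move/(_ t)=> /=; rewrite in_itv/= => /(_ tab).
  near: s; apply: (gC _ tab); exact: open_nbhs_nbhs.
move=> /nbhs_ballP[e/= e0 he]; exists e => // s ste; apply: he.
by rewrite /ball/= ltr_distlC.
Unshelve. all: by end_near. Qed.

(** A constant piece would have an open one-point image. *)
Lemma open_path_neq g a b s t x : (forall y : X, ~ open [set y]) ->
  open_path g a b -> a <= s -> s < t -> t <= b ->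
  exists2 r, s < r < t & g r <> x.
Proof.
move=> niso gp as_ st tb; apply: contrapT => H.
apply: (niso x); have -> : [set x] = g @` `]s, t[; last first.
  exact: open_path_itv gp as_ tb.
have E r : s < r < t -> g r = x.
  by move=> rst; apply: contrapT => ?; apply: H; exists r.
apply/seteqP; split => [y -> /=|y [r/=]].
  exists ((s + t) / 2); last by apply: E; lin.
  by rewrite in_itv/=; lin.
by rewrite in_itv/= => /E ->.
Qed.

Lemma lim_below g a b c (C : set X) s : open_path g a b -> a <= s -> s < c -> c < b ->
  closed C -> (forall t, s < t < c -> C (g t)) -> C (g c).
Proof.
move=> gp as_ sc cb cC H; apply: contrapT => nC.
have [|e e0 he] := open_path_near gp _ (closed_openC cC) nC.
  by rewrite (le_lt_trans as_ sc).
pose t := Num.max ((s + c) / 2) (c - e / 2).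
have t1 : (s + c) / 2 <= t by rewrite le_max lexx.
have t2 : c - e / 2 <= t by rewrite le_max lexx orbT.
have t3 : t < c by rewrite /t gt_max; apply/andP; split; lin.
have [|_] := he t; first by lin.
by apply; apply: H; lin.
Qed.

Lemma exists_sup (P : set R) m : P !=set0 -> (forall t, P t -> t <= m) ->
  exists s, [/\ forall t, P t -> t <= s, s <= m &
    forall e, e < s -> exists2 t, P t & e < t <= s].
Proof.
move=> P0 Pm; have sP : has_sup P by split => //; exists m.
exists (sup P); split.
- by move=> t Pt; apply: ub_le_sup => //; exists m.
- exact: ge_sup.
- move=> e es; have d : 0 < sup P - e by lin.
  have [t Pt ht] := sup_adherent d sP; exists t => //.
  by rewrite (_ : e < t)/=; [apply: ub_le_sup => //; exists m | lin].
Qed.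

Lemma exists_inf (P : set R) m : P !=set0 -> (forall t, P t -> m <= t) ->
  exists s, [/\ forall t, P t -> s <= t, m <= s &
    forall e, s < e -> exists2 t, P t & s <= t < e].
Proof.
move=> [x Px] Pm; have [||s [h1 h2 h3]] := @exists_sup [set t | P (- t)] (- m).
- by exists (- x); rewrite /= opprK.
- by move=> t /Pm; lin.
exists (- s); split; last 1 first.
- move=> e es; have [|t Pt ht] := h3 (- e); first by lin.
  by exists (- t) => //; lin.
- by move=> t Pt; have := h1 (- t); rewrite /= opprK => /(_ Pt); lin.
- by lin.
Qed.

End open_paths.

(** * First visits along an open path *)

Section first_visit.
Context {R : realType} {X : topologicalType}.
Hypothesis hausX : hausdorff_space X.
Implicit Types (g : R -> X) (a b s t u v : R).

Lemma open_path_component g a b s r t (O : set X) : open_path g a b ->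
  a < s -> s < r < t -> t < b -> open O -> O (g r) -> ~ O (g s) -> ~ O (g t) ->
  exists u v, [/\ s <= u < r, r < v <= t, g @` `]u, v[ `<=` O,
    ~ O (g u) & ~ O (g v)].
Proof.
move=> gp as_ /andP[sr rt] tb oO Or Os Ot.
(* [u] is the last parameter before [r], and [v] the first one after it, whose value lies outside
   [O]. *)
have [||u [u1 u2 u3]] := @exists_sup R [set x | s <= x <= r /\ ~ O (g x)] r.
- by exists s => /=; split => //; lin.
- by move=> x [/andP[]].
have [||v [v1 v2 v3]] := @exists_inf R [set x | r <= x <= t /\ ~ O (g x)] r.
- by exists t => /=; split => //; lin.
- by move=> x [/andP[]].
have su : s <= u by apply: u1; split => //; lin.
have vt : v <= t by apply: v1; split => //; lin.
have Ou : ~ O (g u).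
  move=> Ogu; have [|e e0 he] := open_path_near gp _ oO Ogu; first by lin.
  have [|x [_ nO] hx] := u3 (u - e); first by lin.
  by have [|_] := he x; first lin.
have Ov : ~ O (g v).
  move=> Ogv; have [|e e0 he] := open_path_near gp _ oO Ogv; first by lin.
  have [|x [_ nO] hx] := v3 (v + e); first by lin.
  by have [|_] := he x; first lin.
have ur : u != r by apply/eqP => E; apply: Ou; rewrite E.
have vr : v != r by apply/eqP => E; apply: Ov; rewrite E.
exists u, v; split => //.
- by rewrite su lt_neqAle ur.
- by rewrite vt lt_neqAle eq_sym vr v2.
move=> _ [x + <-]; rewrite /= in_itv/= => /andP[ux xv].
apply: contrapT => nO; have [xr|rx] := leP x r.
  have : x <= u by apply: u1; split => //; lin.
  by lin.
have : v <= x by apply: v1; split => //; lin.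
by lin.
Qed.

(** The image of []u, v[] is open, and closed in [O]: the endpoints leave [O], so it is the trace on
    [O] of the compact image of [[u, v]]. *)
Lemma open_path_component_connected g a b s r t (O : set X) :
  open_path g a b -> a < s -> s < r < t -> t < b ->
  open O -> connected O -> O (g r) -> ~ O (g s) -> ~ O (g t) ->
  exists u v, [/\ s <= u < r, r < v <= t, g @` `]u, v[ = O,
    ~ O (g u) & ~ O (g v)].
Proof.
move=> gp as_ srt tb oO cO Or Os Ot.
have [u [v [su vt sub Ou Ov]]] := open_path_component gp as_ srt tb oO Or Os Ot.
exists u, v; split => //; apply: cO.
- by exists (g r), r => //=; rewrite in_itv/=; lin.
- exists (g @` `]u, v[); first by apply: open_path_itv gp _ _; lin.
  by apply/seteqP; split => [x hx|x []//]; split => //; apply: sub.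
- exists (g @` `[u, v]); first by apply: (open_path_closed hausX gp); lin.
  apply/seteqP; split => [x hx|x [Ox [w + gw]]].
    split; first exact: sub.
    case: hx => w /= + <-; rewrite in_itv/= => wuv; exists w => //=.
    by rewrite in_itv/=; lin.
  rewrite /= in_itv/= => wuv; exists w => //=; rewrite in_itv/=.
  have wu : w != u by apply/eqP => E; apply: Ou; rewrite -E gw.
  have wv : w != v by apply/eqP => E; apply: Ov; rewrite -E gw.
  by rewrite !lt_neqAle wv eq_sym wu.
Qed.

(* The first visiting time [r x] of [x]; the first visits form an initial
   segment because the set of repeated times is open and, when it does not
   extend to [v], its right endpoint would be a repeated time as well. *)
Lemma first_visit g a b u v : open_path g a b -> a < u -> u < v -> v < b ->
  ~ (g @` `]u, v[) (g u) ->
  exists r : X -> R,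
    [/\ forall x, (g @` `]u, v[) x -> u < r x < v /\ g (r x) = x,
        forall t, u < t < v -> r (g t) <= t,
        forall s t, u < s -> s <= t -> t < v -> r (g t) = t -> r (g s) = s &
        forall x, (g @` `]u, v[) x -> {for x, continuous r}].
Proof.
move=> gp au uv vb gu.
(* The infimum of the visiting times of [x] is attained by continuity and differs from [u] by the
   hypothesis on [g u]. Outside the image [r] has the default value 0. *)
pose P x := [set s | [/\ u < s < v, g s = x &
  forall t, u < t < v -> g t = x -> s <= t]].
pose r x := xget 0 (P x).
have rP x : (g @` `]u, v[) x -> P x (r x).
  move=> [w + gw]; rewrite /= in_itv/= => wuv.
  apply: xgetPex.
  have [||s [s1 s2 s3]] := @exists_inf R [set t | u < t < v /\ g t = x] u.
  - by exists w.
  - by move=> t [/andP[/ltW]].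
  have sw : s <= w by apply: s1.
  have gs : g s = x.
    apply: contrapT => sx.
    have cx : closed [set x] by apply: accessible_closed_set1; exact: hausdorff_accessible.
    have [|e e0 he] := open_path_near gp _ (closed_openC cx) sx; first by lin.
    have [|t [tuv gt] ts] := s3 (s + e); first by lin.
    by have [|_] := he t; [lin | apply].
  exists s; split => //; last by move=> t tuv gt; apply: s1.
  have us : u != s.
    apply/eqP => E; apply: gu; exists w; first by rewrite /= in_itv/=.
    by rewrite gw E.
  by rewrite lt_neqAle us s2/=; lin.
have gV t : u < t < v -> (g @` `]u, v[) (g t).
  by move=> tuv; exists t => //=; rewrite in_itv/=.
have rle t : u < t < v -> r (g t) <= t.
  by move=> tuv; have [_ _] := rP _ (gV _ tuv); apply.
have rV x : (g @` `]u, v[) x -> u < r x < v /\ g (r x) = x.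
  by move=> /rP[].
have rr t : u < t < v -> r (g (r (g t))) = r (g t).
  by move=> tuv; have [_ ->] := rV _ (gV _ tuv).
exists r; split => //.
- move=> s t us st tv rt; apply: contrapT => rs.
  (* Let [q] be the infimum of the first-visit times in [[s, t]]. Values taken on []s, q[] were
     already taken on [[u, s]]; so [g q] is a repeated value, in the limit, or by assumption when
     [q] is [s]. *)
  have [||q [q1 q2 q3]] := @exists_inf R [set t' | s <= t' <= t /\ r (g t') = t'] s.
  - by exists t; split => //; lin.
  - by move=> ? [/andP[]].
  have qt : q <= t by apply: q1; split => //; lin.
  have H t' : s < t' < q -> (g @` `[u, s]) (g t').
    move=> tsq; have tuv : u < t' < v by lin.
    have [w1 w2] := rV _ (gV _ tuv); exists (r (g t')) => //=.
    rewrite in_itv/=; apply/andP; split; first lin.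
    rewrite leNgt; apply/negP => sw.
    have := rle _ tuv; rewrite le_eqVlt => /orP[/eqP E|lt].
      have : q <= t' by apply: q1; split => //; lin.
      by lin.
    have : q <= r (g t') by apply: q1; split; [lin|rewrite rr].
    by lin.
  have rq : r (g q) < q.
    move: q2; rewrite le_eqVlt => /orP[/eqP E|sq].
      by rewrite -E lt_neqAle rle; [rewrite andbT; apply/eqP|lin].
    have [||||w + gw] := lim_below gp _ sq _ (open_path_closed hausX gp _ _) H; [lin..|].
    rewrite /= in_itv/= => wus.
    have uw : u != w.
      by apply/eqP => E; apply: gu; have -> : g u = g q by [rewrite E]; apply: gV; lin.
    have uw' : u < w by rewrite lt_neqAle uw; lin.
    have := rle w; rewrite gw => /(_ _)/le_lt_trans; apply; lin.
  have quv : u < q < v by lin.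
  have [w1 w2] := rV _ (gV _ quv).
  set w := r (g q) in rq w1 w2.
  (* By openness all values near [g q] are also taken before [(w + q) / 2], so no first visit occurs
     at or just after [q], against the choice of [q]. *)
  have [|||e e0 he] := @open_path_near _ _ g a b q (g @` `]u, (w + q) / 2[) gp.
  - by lin.
  - by apply: open_path_itv gp _ _; lin.
  - by exists w => //=; rewrite in_itv/=; lin.
  have [|t' [t'1 t'2] t'3] := q3 (q + e); first by lin.
  have [|_ [z + gz]] := he t'; first by lin.
  rewrite /= in_itv/= => zu.
  have : r (g z) <= z by apply: rle; lin.
  by rewrite gz t'2; lin.
- move=> x Vx; have [r1 r2] := rV x Vx.
  apply/cvgrPdist_lt => e e0.
  pose al := Num.max ((u + r x) / 2) (r x - e / 2).
  pose be := Num.min ((v + r x) / 2) (r x + e / 2).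
  have al1 : (u + r x) / 2 <= al by rewrite le_max lexx.
  have al2 : r x - e / 2 <= al by rewrite le_max lexx orbT.
  have al3 : al < r x by rewrite /al gt_max; apply/andP; split; lin.
  have be1 : be <= (v + r x) / 2 by rewrite ge_min lexx.
  have be2 : be <= r x + e / 2 by rewrite ge_min lexx orbT.
  have be3 : r x < be by rewrite /be lt_min; apply/andP; split; lin.
  (* Values in this neighborhood of [x] are taken before [be] but not up to [al], so their first
     visits lie between the two. *)
  have oW : open ((g @` `]u, be[) `&` ~` (g @` `[u, al])).
    apply: openI; first by apply: open_path_itv gp _ _; lin.
    by apply: closed_openC; apply: (open_path_closed hausX gp); lin.
  have Wx : ((g @` `]u, be[) `&` ~` (g @` `[u, al])) x.
    split; first by exists (r x) => //=; rewrite in_itv/=; lin.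
    move=> [w + gw]; rewrite /= in_itv/= => wu.
    have uw : u != w.
      by apply/eqP => E; apply: gu; have -> : g u = x by [rewrite E].
    have uw' : u < w by rewrite lt_neqAle uw; lin.
    have : r (g w) <= w by apply: rle; lin.
    by rewrite gw; lin.
  have := open_nbhs_nbhs (conj oW Wx).
  apply: filterS => y [[w + gw] nal]; rewrite /= in_itv/= => wu.
  have yV : (g @` `]u, v[) y by rewrite -gw; apply: gV; lin.
  have ry : r y < be.
    have : r (g w) <= w by apply: rle; lin.
    by rewrite gw; lin.
  have [y1 y2] := rV _ yV.
  have aly : al < r y.
    rewrite ltNge; apply/negP => h; apply: nal; exists (r y) => //=.
    by rewrite in_itv/=; lin.
  by rewrite ltr_norml; lin.
Qed.

End first_visit.

(** * Local structure of an open path at a fold *)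

Section folds.
Context {R : realType} {X : topologicalType}.
Hypothesis hausX : hausdorff_space X.
Hypothesis niso : forall x : X, ~ open [set x].
Implicit Types (g : R -> X) (a b s t u v : R).

(* With [rho] the first visiting time of [g t], openness of [g] forbids interior
   local minima of [rho]; hence [rho] is the identity up to its maximum [p] and
   strictly decreasing afterwards, so that [p] is the only fold. *)
Lemma fold_structure g a b c : open_path g a b -> a < c < b ->
  ~ locally_injective_at g c ->
  exists u v, [/\ a < u < c, c < v < b,
    (forall s t, u < s < t -> t <= c -> g s <> g t),
    (forall s t, c <= s < t -> t < v -> g s <> g t) &
    (forall s, u < s < c -> open (g @` `]s, c])) /\
    (forall t, c < t < v -> open (g @` `[c, t[))].
Proof.
move=> gp /andP[ac cb] nli.
have [|||s0 s0c gs0] := @open_path_neq _ _ g a b ((a + c) / 2) c (g c) niso gp; [lin..|].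
have [|||t0 t0c gt0] := @open_path_neq _ _ g a b c ((b + c) / 2) (g c) niso gp; [lin..|].
have c1 (x : X) : closed [set x].
  by apply: accessible_closed_set1; exact: hausdorff_accessible.
(* Removing two values other than [g c], taken on either side of [c], makes the component around [c]
   end at a parameter [u] whose value is not taken on []u, v[]. *)
pose O := ~` [set g s0] `&` ~` [set g t0].
have oO : open O by apply: openI; apply: closed_openC.
have [|||||||u [v [su vt sub Ou Ov]]] := @open_path_component _ _ g a b s0 c t0 O gp; [lin|lin|lin|by []| | | |].
- by split => /= E; [apply: gs0|apply: gt0]; rewrite E.
- by move=> [/(_ erefl)].
- by move=> [_ /(_ erefl)].
have gu : ~ (g @` `]u, v[) (g u) by move=> /sub.
have [|||r [rV rle rini rcont]] := first_visit hausX gp _ _ _ gu; [lin..|].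
have gV t : u < t < v -> (g @` `]u, v[) (g t).
  by move=> tuv; exists t => //=; rewrite in_itv/=.
have rP t : u < t < v -> u < r (g t) < v /\ g (r (g t)) = g t.
  by move=> tuv; apply: rV; exact: gV.
have rr t : u < t < v -> r (g (r (g t))) = r (g t).
  by move=> tuv; rewrite (rP _ tuv).2.
have rC t : u < t < v -> {for t, continuous (r \o g)}.
  move=> tuv; apply: continuous_comp; last by apply: rcont; exact: gV.
  by apply: gp.1; lin.
have rW s t : u < s -> t < v -> {within `[s, t], continuous (r \o g)}.
  move=> us tv; apply: continuous_in_subspaceT => x.
  by rewrite inE/= in_itv/= => xst; apply: rC; lin.
(* Openness at [t] yields all values near [g t], among them those taken just before the first visit
   [r (g t)]; the parameters there are first visits too. *)
have nomin t e : u < t < v -> 0 < e ->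
    exists t', [/\ u < t' < v, t - e < t' < t + e & r (g t') < r (g t)].
  move=> tuv e0; have [r1 r2] := rP _ tuv.
  pose al := Num.max u (t - e); pose be := Num.min v (t + e).
  have al1 : u <= al by rewrite le_max lexx.
  have al2 : t - e <= al by rewrite le_max lexx orbT.
  have al3 : al < t by rewrite /al gt_max; apply/andP; split; lin.
  have be1 : be <= v by rewrite ge_min lexx.
  have be2 : be <= t + e by rewrite ge_min lexx orbT.
  have be3 : t < be by rewrite /be lt_min; apply/andP; split; lin.
  have [|||d d0 hd] := @open_path_near _ _ g a b (r (g t)) (g @` `]al, be[) gp.
  - by lin.
  - by apply: open_path_itv gp _ _; lin.
  - by rewrite r2; exists t => //=; rewrite in_itv/=; lin.
  pose r' := Num.max ((u + r (g t)) / 2) (r (g t) - d / 2).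
  have r'1 : (u + r (g t)) / 2 <= r' by rewrite le_max lexx.
  have r'2 : r (g t) - d / 2 <= r' by rewrite le_max lexx orbT.
  have r'3 : r' < r (g t) by rewrite /r' gt_max; apply/andP; split; lin.
  have [|_ [t' + gt']] := hd r'; first by lin.
  rewrite /= in_itv/= => t'ab; exists t'; split; [lin|lin|].
  by rewrite gt' (rini r' (r (g t))) ?rr//; lin.
have [s1 [t1 [hs1 ht1 hst1 gst1]]] : exists s t, [/\ u < s < v, u < t < v, s < t & g s = g t].
  apply: contrapT => H; apply: nli.
  exists (Num.min (c - u) (v - c)); first by rewrite lt_min; lin.
  have e1 : Num.min (c - u) (v - c) <= c - u by rewrite ge_min lexx.
  have e2 : Num.min (c - u) (v - c) <= v - c by rewrite ge_min lexx orbT.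
  move=> s t hs ht gst; apply/eqP; rewrite eq_le; apply/andP; split; rewrite leNgt; apply/negP => ?; apply: H.
    by exists t, s; split => //; lin.
  by exists s, t; split => //; lin.
have rt1 : r (g t1) < t1.
  by rewrite -gst1; apply: le_lt_trans hst1; apply: rle.
have r1t t : t1 <= t -> t < v -> r (g t) < t.
  move=> tt tv; rewrite lt_neqAle rle ?andbT; last by lin.
  by apply/eqP => E; have := rini t1 t; rewrite E => /(_ _ tt tv erefl); lin.
(* The value at [t1] is repeated, so first visits stop before [t1]; [p] turns out to be the last of
   them. *)
have [||p [p1 p2 p3]] := @exists_sup R [set s | u < s < v /\ r (g s) = s] t1.
- by exists (r (g t1)); split; [have [] := rP _ ht1|rewrite rr].
- move=> s [suv rs]; rewrite leNgt; apply/negP => ts.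
  by have := r1t s; rewrite rs; lin.
have pu : u < p.
  by have [h _] := rP _ ht1; have := p1 _ (conj h (rr _ ht1)); lin.
have puv : u < p < v by lin.
have rS s : u < s < p -> r (g s) = s.
  move=> sp; have [|t [tuv rt] ht] := p3 s; first by lin.
  by apply: (rini s t) => //; lin.
have rp : r (g p) = p.
  apply/eqP; rewrite eq_le rle//=.
  rewrite leNgt; apply/negP => lt.
  have [e' /= e0 he] : \forall s \near p, r (g s) < (r (g p) + p) / 2.
    have /cvgrPdist_lt := rC _ puv.
    move=> /(_ ((p - r (g p)) / 2)); rewrite /= divr_gt0 ?subr_gt0// => /(_ isT).
    by apply: filterS => s; rewrite ltr_norml; lin.
  pose s := Num.max ((u + p) / 2) (Num.max (p - e' / 2) ((r (g p) + p) / 2)).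
  have s1' : (u + p) / 2 <= s by rewrite le_max lexx.
  have s2' : p - e' / 2 <= s by rewrite !le_max lexx orbT.
  have s3' : (r (g p) + p) / 2 <= s by rewrite !le_max lexx !orbT.
  have s4' : s < p by rewrite /s !gt_max; move: e0; lin.
  have : r (g s) < (r (g p) + p) / 2.
    by apply: he; rewrite /ball/= ltr_norml; move: e0; lin.
  by rewrite rS; lin.
have rlep t : u < t < v -> r (g t) <= p.
  by move=> tuv; apply: p1; split; [have [] := rP _ tuv|exact: rr].
(* Otherwise [r \o g] has a minimum over [[p, t]] at an interior point, against [nomin]: a minimum
   at [t] is also attained at [s], and one at [p] makes the function constant. *)
have rdec s t : p <= s -> s < t -> t < v -> r (g t) < r (g s).
  move=> ps st tv; rewrite ltNge; apply/negP => H.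
  have pt : p <= t by lin.
  have [m mpt hm] := EVT_min pt (rW _ _ pu tv).
  suff [m' m'pt hm'] : exists2 m', p < m' < t & forall x, p <= x <= t -> r (g m') <= r (g x).
    have [||x [x1 x2 x3]] := nomin m' (Num.min (m' - p) (t - m')); first by lin.
      by rewrite lt_min; lin.
    have y1 : Num.min (m' - p) (t - m') <= m' - p by rewrite ge_min lexx.
    have y2 : Num.min (m' - p) (t - m') <= t - m' by rewrite ge_min lexx orbT.
    by have := hm' x; lin.
  have {}hm x : p <= x <= t -> r (g m) <= r (g x).
    by move=> xpt; apply: hm; rewrite in_itv/=.
  move: mpt; rewrite in_itv/= => /andP[pm mt].
  have mp_case : r (g m) = p -> exists2 m', p < m' < t & forall x, p <= x <= t -> r (g m') <= r (g x).
    move=> mp; exists ((p + t) / 2); first by lin.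
    move=> x xpt; have := hm x xpt; rewrite mp; apply: le_trans.
    by apply: rlep; lin.
  move: pm; rewrite le_eqVlt => /orP[/eqP pm|pm].
    by apply: mp_case; rewrite -pm.
  move: mt; rewrite le_eqVlt => /orP[/eqP mt|mt]; last by exists m => //; lin.
  move: ps; rewrite le_eqVlt => /orP[/eqP ps|ps].
    apply: mp_case; apply/eqP; rewrite eq_le rlep/=; last by lin.
    by rewrite -[leLHS]rp {1}ps mt.
  exists s; first by lin.
  by move=> x xpt; apply: le_trans (hm x xpt); rewrite mt.
(* On either side of [p] the map [r \o g] is strictly monotone, so only [p] can be a fold. *)
have cp : c = p.
  apply/eqP; rewrite eq_le; apply/andP; split; rewrite leNgt; apply/negP => lt; apply: nli.
    exists (Num.min (c - p) (v - c)); first by rewrite lt_min; lin.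
    have e1 : Num.min (c - p) (v - c) <= c - p by rewrite ge_min lexx.
    have e2 : Num.min (c - p) (v - c) <= v - c by rewrite ge_min lexx orbT.
    move=> s t hs ht gst; have [st|ts|//] := ltgtP s t.
      by have := rdec s t; rewrite gst ltxx; lin.
    by have := rdec t s; rewrite gst ltxx; lin.
  exists (Num.min (c - u) (p - c)); first by rewrite lt_min; lin.
  have e1 : Num.min (c - u) (p - c) <= c - u by rewrite ge_min lexx.
  have e2 : Num.min (c - u) (p - c) <= p - c by rewrite ge_min lexx orbT.
  by move=> s t hs ht gst; rewrite -(rS s) ?gst ?rS//; lin.
have rS' s : u < s <= p -> r (g s) = s.
  move=> /andP[us]; rewrite le_eqVlt => /orP[/eqP->//|sp].
  by apply: rS; lin.
(* These are exactly the values on []u, v[] that avoid the closed image of [[u, s]]. *)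
have oL s : u < s < p -> open (g @` `]s, p]).
  move=> sup.
  rewrite (_ : _ @` _ = (g @` `]u, v[) `&` ~` (g @` `[u, s])).
    apply: openI; first by apply: open_path_itv gp _ _; lin.
    by apply: closed_openC; apply: (open_path_closed hausX gp); lin.
  apply/seteqP; split => [_ [w + <-]|y [[w + gw] nus]]; rewrite /= in_itv/= => hw.
    split; first by apply: gV; lin.
    move=> [z + gz]; rewrite /= in_itv/= => hz.
    have uz : u != z.
      by apply/eqP => E; apply: gu; have -> : g u = g w by [rewrite E]; apply: gV; lin.
    have uz' : u < z by rewrite lt_neqAle uz; lin.
    have : r (g z) <= z by apply: rle; lin.
    by rewrite gz rS'; lin.
  have [w1 w2] := rP _ hw; exists (r (g w)); last by rewrite w2.
  rewrite /= in_itv/= rlep// andbT ltNge; apply/negP => h; apply: nus.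
  by exists (r (g w)); [rewrite /= in_itv/=; lin|rewrite w2].
exists u, v; rewrite cp; split.
- by lin.
- by lin.
- move=> s t ust tc gst.
  by have := rS' s; rewrite gst (rS' t); lin.
- move=> s t pst tv gst.
  by have := rdec s t; rewrite gst ltxx; lin.
split=> // t ptv.
(* The way back retraces the way up to the fold: by the intermediate value theorem [r \o g] maps
   [[p, t[] onto []r (g t), p]]. *)
rewrite (_ : _ @` _ = g @` `]r (g t), p]); last first.
  have rtp : r (g t) <= p by apply: rlep; lin.
  have tuv : u < t < v by lin.
  apply/seteqP; split => [_ [w + <-]|_ [w + <-]]; rewrite /= in_itv/= => hw.
    have wuv : u < w < v by lin.
    exists (r (g w)); last by have [] := rP w wuv.
    by rewrite /= in_itv/= rlep// andbT; apply: rdec; lin.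
  have [|||s + rs] := @IVT R (r \o g) p t w.
  - by lin.
  - by apply: rW; lin.
  - rewrite /= rp ge_min le_max; apply/andP; split; apply/orP; [right|left]; lin.
  rewrite in_itv/= => hs; exists s.
    rewrite /= in_itv/=; apply/andP; split; first lin.
    rewrite lt_neqAle; apply/andP; split; last lin.
    by apply/eqP => E; move: rs hw; rewrite E /=; lin.
  by rewrite -rs /= (rP s _).2//; lin.
have rtp : r (g t) < p by rewrite -[ltRHS]rp; apply: rdec; lin.
by have [|? _] := rP t; [lin|apply: oL; lin].
Qed.

End folds.

(** * Arcs and circles as quotients of a segment *)

Lemma homeomorphic_range (T U : topologicalType) (f : T -> U) (A : set U) :
  compact [set: T] -> hausdorff_space U -> continuous f -> injective f ->
  range f = A -> homeomorphic T (set_type A).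
Proof.
move=> cT hU cf fI fA.
have fin x : f x \in A by rewrite inE -fA; exists x.
have [h hE] : {h : set_type A -> T & forall y, f (h y) = set_val y}.
  apply: (choice (P := fun (y : set_type A) x => f x = set_val y)) => y.
  by have : A (set_val y) by [exact: set_valP]; rewrite -{1}fA => -[x _ <-]; exists x.
exists (fun x => exist _ (f x) (fin x)), h; split.
- exact: continuous_comp_initial.
- apply/continuous_closedP => C cC.
  (* The inverse pulls a closed [C] back to its image under [f], which is compact and hence
     closed. *)
  rewrite (_ : _ @^-1` _ = set_val @^-1` (f @` C)).
    apply: preimage_closed; first by move=> ? _; exact: initial_continuous.
    apply: compact_closed => //; apply: continuous_compact.
      exact: continuous_subspaceT.
    by apply: subclosed_compact cC cT _.
  apply/seteqP; split => [y Cy|y [x Cx fx]] /=; first by exists (h y).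
  by have -> : h y = x by apply: fI; rewrite hE.
- by move=> x; apply: fI; rewrite hE.
- by move=> y; apply: val_inj; rewrite /= hE.
Qed.

Section path_quotients.
Context {R : realType} {X : topologicalType}.
Hypothesis hausX : hausdorff_space X.
Implicit Types (g : R -> X) (p q : R).

(** By compactness [g] is a closed map from [[p, q]] onto [X], hence a quotient map, and continuity
    of [f] can be tested after composing with [g]. *)
Lemma path_quotient_continuous (Y : topologicalType) g p q (e : R -> Y) (f : X -> Y) :
  {within `[p, q], continuous g} -> (forall x, (g @` `[p, q]) x) ->
  continuous e -> (forall w, p <= w <= q -> f (g w) = e w) -> continuous f.
Proof.
move=> cg gs ce fg; apply/continuous_closedP => C cC.
rewrite (_ : _ @^-1` _ = g @` (`[p, q] `&` e @^-1` C)).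
  apply: compact_closed => //; apply: continuous_compact.
    by apply: continuous_subspaceW cg => ? [].
  apply: compact_closedI; first exact: segment_compact.
  by apply: preimage_closed => // ? _; exact: ce.
apply/seteqP; split => [x /=|_ [w [+ Cw] <-]]/=.
  have [w + <-] := gs x; rewrite /= in_itv/= => hw; rewrite fg// => Cw.
  by exists w => //; split => //=; rewrite in_itv.
by rewrite /= in_itv/= => hw; rewrite fg.
Qed.

Lemma arc_of_path g p q : compact [set: X] -> p < q ->
  {within `[p, q], continuous g} -> (forall x, (g @` `[p, q]) x) ->
  (forall s t, p <= s < t -> t <= q -> g s <> g t) ->
  homeomorphic X (set_type (@unit_interval R)).
Proof.
move=> cX pq cg gs gI.
have [w hw] : {w : X -> R & forall x, p <= w x <= q /\ g (w x) = x}.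
  apply: (choice (P := fun x w => p <= w <= q /\ g w = x)) => x.
  by have [w + <-] := gs x; rewrite /= in_itv/= => ?; exists w.
have gI' s t : p <= s <= q -> p <= t <= q -> g s = g t -> s = t.
  by move=> hs ht gst; have [st|ts|//] := ltgtP s t;
    [have := gI s t|have := gI t s]; rewrite gst => h; exfalso; apply: h => //; lin.
have wg t : p <= t <= q -> w (g t) = t.
  by move=> ht; have [h1 h2] := hw (g t); apply: gI'.
pose e t := (t - p) / (q - p).
have pq0 : q - p != 0 by rewrite subr_eq0; apply/eqP; lin.
have ec : continuous e.
  by move=> t; apply: cvgM; [apply: cvgB; [exact: cvg_id|exact: cvg_cst]|exact: cvg_cst].
apply: (@homeomorphic_range X R (e \o w)) => //.
- by apply: (path_quotient_continuous cg gs ec) => t ht /=; rewrite wg.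
- move=> x y /= /(congr1 ( *%R^~ (q - p))); rewrite /e !divfK// => exy.
  have [_ <-] := hw x; have [_ <-] := hw y; congr g; lra.
- have d0 : 0 < q - p by lin.
  apply/seteqP; split => [_ [x _ <-]|t].
    have [h _] := hw x; rewrite /unit_interval /= in_itv/= /e.
    by rewrite divr_ge0 ?ler_pdivrMr ?mul1r//; lin.
  rewrite /unit_interval /= in_itv/= => /andP[t0 t1].
  have h1 : 0 <= t * (q - p) by apply: mulr_ge0 => //; lin.
  have h2 : t * (q - p) <= q - p by rewrite ler_piMl//; lin.
  exists (g (p + t * (q - p))) => //=; rewrite wg; last by lin.
  by rewrite /e addrC addKr mulfK.
Qed.

End path_quotients.

Section circle_param.
Context {R : realType}.
Implicit Types x y s t : R.
Local Open Scope complex_scope.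

(** The difference of the angles would have cosine 1, which does not happen strictly between 0 and
    [2 pi]. *)
Lemma cos_sin_inj s t : 0 <= s < pi *+ 2 -> 0 <= t < pi *+ 2 ->
  cos s = cos t -> sin s = sin t -> s = t.
Proof.
have key d : 0 < d < pi *+ 2 -> cos d <> 1.
  move=> d0 cd; have p0 : (0 : R) < pi by exact: pi_gt0.
  have [dp|pd] := leP d pi.
    have : d = 0 by apply: cos_inj; rewrite ?in_itv/= ?cos0//; lra.
    by lra.
  have : pi *+ 2 - d = 0.
    by apply: cos_inj; rewrite ?in_itv/= ?cos0//; [lra|lra|rewrite addrC cosD2pi cosN].
  by lra.
move=> hs ht cst sst; have [st|ts|//] := ltgtP s t; exfalso.
  suff: cos (t - s) = 1 by apply: key; lra.
  by rewrite cosB cst sst -!expr2 cos2Dsin2.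
suff: cos (s - t) = 1 by apply: key; lra.
by rewrite cosB cst sst -!expr2 cos2Dsin2.
Qed.

Lemma cos_sin_surj x y : x ^+ 2 + y ^+ 2 = 1 ->
  exists2 t, 0 <= t < pi *+ 2 & cos t = x /\ sin t = y.
Proof.
move=> xy; have p0 : (0 : R) < pi by exact: pi_gt0.
have x1 : -1 <= x <= 1 by have y2 := sqr_ge0 y; apply/andP; split; nra.
have sa : sin (acos x) = `|y|.
  by rewrite sin_acos// -sqrtr_sqr; congr Num.sqrt; lra.
have [a0 ap] : 0 <= acos x /\ acos x <= pi by split; [exact: acos_ge0|exact: acos_lepi].
have ca : cos (acos x) = x by apply: acosK; rewrite in_itv/=.
(* The angle is [acos x] on the upper half circle and [2 pi - acos x] below it. *)
have [y0|y0] := leP 0 y.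
  by exists (acos x); [lra|rewrite sa ger0_norm].
exists (pi *+ 2 - acos x).
  have y2 : 0 < y ^+ 2 by rewrite exprn_even_gt0//= lt_eqF.
  have : 0 < acos x by apply: acos_gt0; apply/andP; split; nra.
  by lra.
by rewrite addrC cosD2pi sinD2pi cosN sinN sa ltr0_norm// opprK.
Qed.

(** The point $e^{it}$ of the complex plane. *)
Definition cis t : R[i]^o := cos t +i* sin t.

Lemma continuous_cis : continuous cis.
Proof.
move=> t; apply/cvgrPdist_lt => e e0.
(* In the partial order of the complex numbers a positive [e] is real. *)
have e'0 : 0 < complex.Re e by move: e0; case: e => a b; rewrite ltcE/= => /andP[].
have ee : e = (complex.Re e)%:C.
  by move: e0; case: e {e'0} => a b; rewrite ltcE/= => /andP[/eqP-> _].
have h : 0 < complex.Re e / 2 by rewrite divr_gt0.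
have /cvgrPdist_lt/(_ _ h) hc := @continuous_cos R t.
have /cvgrPdist_lt/(_ _ h) hs := @continuous_sin R t.
near=> s.
rewrite ee normc_def ltcR /cis /=.
have c1 : `|cos t - cos s| < complex.Re e / 2 by near: s.
have s1 : `|sin t - sin s| < complex.Re e / 2 by near: s.
apply: (@le_lt_trans _ _ (`|cos t - cos s| + `|sin t - sin s|)); last by lra.
rewrite -[leRHS]ger0_norm ?addr_ge0// -sqrtr_sqr ler_wsqrtr//.
rewrite [leRHS]sqrrD !real_normK ?num_real// [leRHS]addrAC lerDl.
by rewrite mulrn_wge0// mulr_ge0.
Unshelve. all: by end_near. Qed.

Lemma range_cis : range cis = @unit_circle R.
Proof.
apply/seteqP; split => [_ [t _ <-]|[x y]]; rewrite /unit_circle /= normc_def/=.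
  by rewrite cos2Dsin2 sqrtr1.
move=> /(congr1 (@complex.Re _)) /= sq.
have xy : x ^+ 2 + y ^+ 2 = 1.
  by rewrite -[LHS]sqr_sqrtr ?addr_ge0 ?sqr_ge0// sq expr1n.
have [t _ [cx sy]] := cos_sin_surj xy.
by exists t => //; rewrite /cis cx sy.
Qed.
End circle_param.

Section circle_quotient.
Context {R : realType} {X : topologicalType}.
Hypothesis hausX : hausdorff_space X.

Lemma circle_of_path (g : R -> X) (p q : R) : compact [set: X] -> p < q ->
  {within `[p, q], continuous g} -> (forall x, (g @` `[p, q]) x) ->
  g p = g q ->
  (forall s t, p <= s < t -> t < q -> g s <> g t) ->
  homeomorphic X (set_type (@unit_circle R)).
Proof.
move=> cX pq cg gs gpq gI.
have [w hw] : {w : X -> R & forall x, p <= w x < q /\ g (w x) = x}.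
  apply: (choice (P := fun x w => p <= w < q /\ g w = x)) => x.
  have [w + <-] := gs x; rewrite /= in_itv/= => /andP[pw].
  rewrite le_eqVlt => /orP[/eqP->|wq]; first by exists p; split => //; lin.
  by exists w; rewrite pw wq.
have gI' s t : p <= s < q -> p <= t < q -> g s = g t -> s = t.
  by move=> hs ht gst; have [st|ts|//] := ltgtP s t;
    [have := gI s t|have := gI t s]; rewrite gst => h; exfalso; apply: h => //; lin.
have wg t : p <= t < q -> w (g t) = t.
  by move=> ht; have [h1 h2] := hw (g t); apply: gI'.
(* [th] maps [[p, q]] affinely onto [[0, 2 pi]], so that [cis \o th] identifies [p] and [q] just as
   [g] does. *)
pose th t : R := (t - p) * (pi *+ 2 / (q - p)).
have p0 : 0 < pi *+ 2 :> R by rewrite mulrn_wgt0// pi_gt0.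
have k0 : 0 < pi *+ 2 / (q - p) by rewrite divr_gt0//; lin.
have thc : continuous th.
  by move=> t; apply: cvgM; [apply: cvgB; [exact: cvg_id|exact: cvg_cst]|exact: cvg_cst].
have ec : continuous (cis \o th).
  by move=> t; apply: continuous_comp; [exact: thc|exact: continuous_cis].
have thq : th q = pi *+ 2 by rewrite /th mulrC divfK// gt_eqF//; lin.
have th0 : th p = 0 by rewrite /th subrr mul0r.
have thb t : p <= t < q -> 0 <= th t < pi *+ 2.
  move=> tpq; rewrite -thq /th ltr_pM2r// mulr_ge0 ?(ltW k0)//=; lin.
have epq : cis (th q) = cis (th p).
  by rewrite th0 thq /cis -[X in cos X]add0r -[X in sin X]add0r cosD2pi sinD2pi.
apply: (@homeomorphic_range X (R[i]^o) ((cis \o th) \o w)) => //.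
- apply: (path_quotient_continuous hausX cg gs ec) => t /andP[pt].
  rewrite le_eqVlt => /orP[/eqP->|tq] /=; last by rewrite wg// pt.
  by rewrite -gpq wg ?epq// lexx.
- move=> x y /= -[cxy sxy].
  have [h1 <-] := hw x; have [h2 <-] := hw y; congr g.
  have := cos_sin_inj (thb _ h1) (thb _ h2) cxy sxy.
  rewrite /th => /mulIf; rewrite gt_eqF// => /(_ isT)/addIr; exact.
- rewrite -range_cis; apply/seteqP; split => [_ [x _ <-]|_ [t _ <-]].
    by exists (th (w x)).
  have [t' t'b [ct st]] := cos_sin_surj (cos2Dsin2 t).
  pose z := p + t' / (pi *+ 2 / (q - p)).
  have thz : th z = t' by rewrite /th /z addrC addKr divfK// gt_eqF.
  have zpq : p <= z < q.
    have z0 : 0 <= t' / (pi *+ 2 / (q - p)) by apply: divr_ge0; [lin|exact: ltW].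
    have z1 : t' / (pi *+ 2 / (q - p)) < q - p.
      rewrite ltr_pdivrMr// mulrC divfK ?gt_eqF//; lin.
    by rewrite /z; apply/andP; split; lin.
  by exists (g z) => //=; rewrite wg// thz /cis ct st.
Qed.
End circle_quotient.

(** * Loops and folds in a compact connected space *)

Section loops_and_folds.
Context {R : realType} {X : topologicalType}.
Hypothesis hausX : hausdorff_space X.
Hypothesis cptX : compact [set: X].
Hypothesis conX : connected [set: X].
Implicit Types (g : R -> X) (a b s t u v : R).

Lemma clopen_setT (K : set X) : open K -> closed K -> K !=set0 -> forall x, K x.
Proof.
move=> oK cK K0 x; rewrite (conX K0 _ _) //.
  by exists K => //; rewrite setTI.
by exists K => //; rewrite setTI.
Qed.

Lemma locally_injective_near g c : locally_injective_at g c ->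
  exists2 e : R, 0 < e & forall c', c - e < c' < c + e -> locally_injective_at g c'.
Proof.
move=> [e e0 inj]; exists (e / 2); first by lin.
move=> c' hc'; exists (e / 2); first by lin.
by move=> s t hs ht; apply: inj; lin.
Qed.

Lemma loop_circle g a b v0 v1 : open_path g a b -> a < v0 -> v0 < v1 -> v1 < b ->
  g v0 = g v1 -> (forall c, v0 <= c <= v1 -> locally_injective_at g c) ->
  homeomorphic X (set_type (@unit_circle R)).
Proof.
move=> gp av0 v01 v1b gv li.
(* [tau] is the first parameter that repeats a value taken since [v0]. *)
pose P := [set t | t <= v1 /\ exists2 s, v0 <= s < t & g s = g t].
have [||tau [tau1 tau2 tau3]] := @exists_inf R P v0.
- by exists v1; split => //; exists v0 => //; lin.
- by move=> t [_ [s]]; lin.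
have tauv : tau <= v1 by apply: tau1; split => //; exists v0 => //; lin.
have [sig hsig gsig] : exists2 s, v0 <= s < tau & g s = g tau.
  (* If [g tau] were new, local injectivity at [tau] and closedness of the earlier image would
     exclude repetitions just after [tau]. *)
  apply: contrapT => nex.
  have [|e e0 inj] := li tau; first by lin.
  have Ctau : ~ (g @` `[v0, tau - e / 2]) (g tau).
    by move=> [s + gs]; rewrite /= in_itv/= => hs; apply: nex; exists s => //; lin.
  have [||e' e'0 he'] := open_path_near gp _ (closed_openC (open_path_closed hausX gp av0 _)) Ctau.
  - by lin.
  - by lin.
  have [|t [tv1 [s hs gs]] ht] := tau3 (tau + Num.min e e').
    by have : 0 < Num.min e e' by [rewrite lt_min e0]; lin.
  have m1 : Num.min e e' <= e by rewrite ge_min lexx.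
  have m2 : Num.min e e' <= e' by rewrite ge_min lexx orbT.
  have [|_] := he' t; first by lin.
  apply; exists s => //=; rewrite in_itv/=; apply/andP; split; first by lin.
  rewrite leNgt; apply/negP => hs'.
  by have : s = t by [apply: inj => //; lin]; lin.
have inj s t : sig <= s < t -> t < tau -> g s <> g t.
  move=> hst ttau gst.
  by have : tau <= t by [apply: tau1; split; [lin|exists s => //; lin]]; lin.
have [|e1 e10 inj1] := li sig; first by lin.
pose e := Num.min (e1 / 2) (Num.min ((tau - sig) / 2) (Num.min ((sig - a) / 2) ((b - sig) / 2))).
have [e0 ee1 et ea eb] : [/\ 0 < e, e <= e1 / 2, e <= (tau - sig) / 2,
    e <= (sig - a) / 2 & e <= (b - sig) / 2].
  by split; rewrite /e ?lt_min ?ge_min ?lexx ?orbT//; lin.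
have injse s t : sig - e <= s <= sig + e -> sig - e <= t <= sig + e -> g s = g t -> s = t.
  by move=> hs ht; apply: inj1; lin.
have [||||r [rV _ _ rcont]] := @first_visit _ _ hausX g a b (sig - e) (sig + e) gp; [lin|lin|lin| |].
  move=> [w + gw]; rewrite /= in_itv/= => hw.
  by have : w = sig - e by [apply: injse => //; lin]; lin.
pose O := g @` `]sig - e, sig + e[.
have oO : open O by apply: open_path_itv gp _ _; lin.
have Osig : O (g tau) by exists sig => //=; rewrite in_itv/=; lin.
have [|d d0 hd] := open_path_near gp _ oO Osig; first by lin.
pose t0 := Num.max (tau - d / 2) (tau - e / 2).
have [t01 t02 t03] : [/\ tau - d / 2 <= t0, tau - e / 2 <= t0 & t0 < tau].
  by split; rewrite /t0 ?gt_max ?le_max ?lexx ?orbT//; lin.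
have Ot t : t0 <= t <= tau -> O (g t) by move=> ht; have [|] := hd t; first by lin.
(* Just before [tau] the path runs along the part of [O] that precedes [sig]: a first visit from
   [sig] on would repeat a value within [[sig, tau[]. *)
have rt t : t0 <= t < tau -> r (g t) < sig.
  move=> ht; have [|h1 h2] := rV (g t); first by apply: Ot; lin.
  rewrite ltNge; apply/negP => h3.
  by apply: (inj (r (g t)) t) => //; lin.
have rtau : r (g tau) = sig.
  by have [h1 h2] := rV _ Osig; apply: injse; [lin|lin|rewrite h2].
have rC : {within `[t0, tau], continuous (r \o g)}.
  apply: continuous_in_subspaceT => x; rewrite inE/= in_itv/= => hx.
  by apply: continuous_comp; [apply: gp.1; lin|apply: rcont; exact: Ot].
have s0 : r (g t0) < sig by apply: rt; lin.
have [s1 _] : sig - e < r (g t0) < sig + e /\ g (r (g t0)) = g t0.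
  by apply: rV; apply: Ot; lin.
(* By the intermediate value theorem the stretch before [tau] covers the values just before [sig].
   The loop is thus a union of two open images, hence open and closed. *)
have KE : g @` `[sig, tau] = g @` `]sig, tau[ `|` g @` `]r (g t0), sig + e[.
  apply/seteqP; split => [_ [w + <-]|_ [] [w + <-]]; rewrite /= in_itv/= => hw.
  - have [E|ws] := eqVneq w sig.
      by right; exists w => //=; rewrite in_itv/=; lin.
    have [E|wt] := eqVneq w tau.
      by right; exists sig; rewrite ?E//= in_itv/=; lin.
    by left; exists w => //=; rewrite in_itv/= !lt_neqAle wt eq_sym ws.
  - by exists w => //=; rewrite in_itv/=; lin.
  - have [ws|sw] := leP w sig; last by exists w => //=; rewrite in_itv/=; lin.
    have [|||t + rgt] := @IVT R (r \o g) t0 tau w => //.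
    + by lin.
    + by rewrite /= rtau ge_min le_max; apply/andP; split; apply/orP; [left|right]; lin.
    rewrite in_itv/= => ht; exists t; first by rewrite /= in_itv/=; lin.
    by rewrite -rgt /=; have [|_ ->] := rV (g t); first exact: Ot.
have Kall : forall x, (g @` `[sig, tau]) x.
  apply: clopen_setT.
  - by rewrite KE; apply: openU; apply: open_path_itv gp _ _; lin.
  - by apply: (open_path_closed hausX gp); lin.
  - by exists (g sig), sig => //=; rewrite in_itv/=; lin.
apply: (circle_of_path hausX cptX _ _ Kall gsig inj); first by lin.
by apply: (open_path_within gp); lin.
Qed.

Hypothesis niso : forall x : X, ~ open [set x].

(** A repeated value between the folds would give a loop without folds. The one-sided images at the
    folds are open, which extends injectivity to the endpoints and makes the whole arc open. *)
Lemma adjacent_folds g a b p1 p2 : open_path g a b -> a < p1 -> p1 < p2 -> p2 < b ->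
  ~ locally_injective_at g p1 -> ~ locally_injective_at g p2 ->
  (forall c, p1 < c < p2 -> locally_injective_at g c) ->
  homeomorphic X (set_type (@unit_interval R)) \/
  homeomorphic X (set_type (@unit_circle R)).
Proof.
move=> gp ap1 p12 p2b n1 n2 li.
have [circ|ncirc] := pselect (homeomorphic X (set_type (@unit_circle R))).
  by right.
left.
have [|u1 [w1 [hu1 hw1 _ _ [_ opn1]]]] := fold_structure hausX niso gp _ n1; first by lin.
have [|u2 [w2 [hu2 hw2 _ _ [opn2 _]]]] := fold_structure hausX niso gp _ n2; first by lin.
have inj_in s t : p1 < s -> s < t -> t < p2 -> g s <> g t.
  move=> ps st tp gst; apply: ncirc.
  by apply: (loop_circle gp _ st _ gst); [lin|lin|move=> c hc; apply: li; lin].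
have inj_l s t : p1 < s -> s < t -> t <= p2 -> g s <> g t.
  move=> ps st; rewrite le_eqVlt => /orP[/eqP E|tp gst]; last exact: (inj_in s t).
  rewrite {t}E in st * => gst.
  (* If [g s] were [g p2], the open image of []m, p2]] would contain values taken just after [s] and
     different from [g p2]; these would be repeated strictly between the folds. *)
  pose m := Num.max ((u2 + p2) / 2) ((s + p2) / 2).
  have [m1 m2 m3] : [/\ (u2 + p2) / 2 <= m, (s + p2) / 2 <= m & m < p2].
    by split; rewrite /m ?gt_max ?le_max ?lexx ?orbT//; lin.
  have oO : open (g @` `]m, p2]) by apply: opn2; lin.
  have Os : (g @` `]m, p2]) (g s) by exists p2 => //=; rewrite in_itv/=; lin.
  have [|e e0 he] := open_path_near gp _ oO Os; first by lin.
  pose m' := Num.min m (s + e).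
  have [m'1 m'2 m'3] : [/\ m' <= m, m' <= s + e & s < m'].
    by split; rewrite /m' ?lt_min ?ge_min ?lexx ?orbT//; lin.
  have [|||s' hs' gs'] := @open_path_neq _ _ g a b s m' (g p2) niso gp; [lin|lin|lin|].
  have [|_ [t' + gt']] := he s'; first by lin.
  rewrite /= in_itv/= => ht'.
  have t'p : t' != p2 by apply/eqP => E; apply: gs'; rewrite -E gt'.
  have t'p2 : t' < p2 by rewrite lt_neqAle t'p; lin.
  by apply: (inj_in s' t') => //; lin.
have inj s t : p1 <= s < t -> t <= p2 -> g s <> g t.
  move=> /andP[]; rewrite le_eqVlt => /orP[/eqP<-|ps] p1t tp; last exact: inj_l.
  move=> gst.
  pose m := Num.min ((w1 + p1) / 2) ((p1 + t) / 2).
  have [m1 m2 m3] : [/\ m <= (w1 + p1) / 2, m <= (p1 + t) / 2 & p1 < m].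
    by split; rewrite /m ?lt_min ?ge_min ?lexx ?orbT//; lin.
  have oO : open (g @` `[p1, m[) by apply: opn1; lin.
  have Ot : (g @` `[p1, m[) (g t) by exists p1 => //=; rewrite in_itv/=; lin.
  have [|e e0 he] := open_path_near gp _ oO Ot; first by lin.
  pose m' := Num.max m (t - e).
  have [m'1 m'2 m'3] : [/\ m <= m', t - e <= m' & m' < t].
    by split; rewrite /m' ?gt_max ?le_max ?lexx ?orbT//; lin.
  have [|||t' ht' gt'] := @open_path_neq _ _ g a b m' t (g p1) niso gp; [lin|lin|lin|].
  have [|_ [s' + gs']] := he t'; first by lin.
  rewrite /= in_itv/= => hs'.
  have s'p : p1 != s' by apply/eqP => E; apply: gt'; rewrite E gs'.
  have s'p1 : p1 < s' by rewrite lt_neqAle s'p; lin.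
  by apply: (inj_l s' t') => //; lin.
have KE : g @` `[p1, p2] =
    g @` `[p1, (p1 + Num.min w1 p2) / 2[ `|` g @` `]p1, p2[ `|`
    g @` `](Num.max p1 u2 + p2) / 2, p2].
  have mw : Num.min w1 p2 <= p2 by rewrite ge_min lexx orbT.
  have mw' : p1 < Num.min w1 p2 by rewrite lt_min; lin.
  have mu : p1 <= Num.max p1 u2 by rewrite le_max lexx.
  have mu' : Num.max p1 u2 < p2 by rewrite gt_max; lin.
  apply/seteqP; split => [_ [w + <-]|_ [[]|] [w + <-]]; rewrite /= in_itv/= => hw.
  - have [->|ws] := eqVneq w p1.
      by left; left; exists p1 => //=; rewrite in_itv/=; lin.
    have [->|wt] := eqVneq w p2.
      by right; exists p2 => //=; rewrite in_itv/=; lin.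
    by left; right; exists w => //=; rewrite in_itv/= !lt_neqAle wt eq_sym ws.
  - by exists w => //=; rewrite in_itv/=; lin.
  - by exists w => //=; rewrite in_itv/=; lin.
  - by exists w => //=; rewrite in_itv/=; lin.
have Kall : forall x, (g @` `[p1, p2]) x.
  apply: clopen_setT.
  - have mw : Num.min w1 p2 <= w1 by rewrite ge_min lexx.
    have mw' : p1 < Num.min w1 p2 by rewrite lt_min; lin.
    have mu : u2 <= Num.max p1 u2 by rewrite le_max lexx orbT.
    have mu' : Num.max p1 u2 < p2 by rewrite gt_max; lin.
    rewrite KE; apply: openU; first apply: openU.
    + by apply: opn1; lin.
    + by apply: open_path_itv gp _ _; lin.
    + by apply: opn2; lin.
  - by apply: (open_path_closed hausX gp); lin.
  - by exists (g p1), p1 => //=; rewrite in_itv/=; lin.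
apply: (arc_of_path hausX cptX p12 _ Kall) => //.
by apply: (open_path_within gp); lin.
Qed.

(** Folds form a closed set and do not accumulate at [p1] from the right, so [p1] has a next fold,
    adjacent to it. *)
Lemma two_folds g a b p1 p2 : open_path g a b -> a < p1 -> p1 < p2 -> p2 < b ->
  ~ locally_injective_at g p1 -> ~ locally_injective_at g p2 ->
  homeomorphic X (set_type (@unit_interval R)) \/
  homeomorphic X (set_type (@unit_circle R)).
Proof.
move=> gp ap1 p12 p2b n1 n2.
have [|u1 [w1 [_ hw1 _ inj1 _]]] := fold_structure hausX niso gp _ n1; first by lin.
pose P := [set c | p1 < c <= p2 /\ ~ locally_injective_at g c].
have [||p [q1 q2 q3]] := @exists_inf R P p1.
- by exists p2; split => //; lin.
- by move=> t []; lin.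
have pp2 : p <= p2 by apply: q1; split => //; lin.
have near1 c : p1 < c < w1 -> locally_injective_at g c.
  move=> hc; exists (Num.min (c - p1) (w1 - c)); first by rewrite lt_min; lin.
  have m1 : Num.min (c - p1) (w1 - c) <= c - p1 by rewrite ge_min lexx.
  have m2 : Num.min (c - p1) (w1 - c) <= w1 - c by rewrite ge_min lexx orbT.
  move=> s t hs ht gst; have [st|ts|//] := ltgtP s t.
    by have := inj1 s t; rewrite gst => h; exfalso; apply: h => //; lin.
  by have := inj1 t s; rewrite gst => h; exfalso; apply: h => //; lin.
have w1p : w1 <= p.
  rewrite leNgt; apply/negP => pw.
  by have [c [hc nc] hc'] := q3 _ pw; apply: nc; apply: near1; lin.
have np : ~ locally_injective_at g p.
  move=> /locally_injective_near[e e0 he].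
  have [|c [hc nc] hc'] := q3 (p + e); first by lin.
  by apply: nc; apply: he; lin.
apply: (adjacent_folds gp ap1 _ _ n1 np); [lin|lin|].
move=> c hc; apply: contrapT => nc.
by have : p <= c by [apply: q1; split => //; lin]; lin.
Qed.

End loops_and_folds.

(** * Sensitivity and paths swept across small open sets *)

Lemma count_lt (T : eqType) (P Q : pred T) (s : seq T) x :
  (forall y, P y -> Q y) -> x \in s -> Q x -> ~~ P x -> (count P s < count Q s)%N.
Proof.
move=> PQ xs Qx Px; rewrite -[ltnRHS]size_filter -(count_predC P).
rewrite !count_filter.
rewrite (@eq_count _ (predI P Q) P); last first.
  by move=> y /=; have [/PQ->|] := boolP (P y).
rewrite -addn1 leq_add2l -has_count; apply/hasP; exists x => //=.
by rewrite Px Qx.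
Qed.

Section sensitive_dynamics.
Context {R : realType} {X : metricType R}.
Implicit Types (g : R -> X) (f : X -> X) (a b s t u v : R) (F : set (X -> X)).

Lemma continuous_mdist (x : X) : continuous (mdist x).
Proof.
move=> y; apply/cvgrPdist_lt => e e0.
near=> z; have : ball y e z by near: z; exact: nbhsx_ballx.
rewrite ballEmdist/= => yz.
have h1 := metric_triangle x y z; have h2 := metric_triangle x z y.
have h3 := metric_sym y z.
by rewrite ltr_norml; apply/andP; split; lra.
Unshelve. all: by end_near. Qed.

Lemma open_path_comp g f a b : continuous f -> open_map f ->
  open_path g a b -> open_path (f \o g) a b.
Proof.
move=> fc fo [gc go]; split => [t tab|U oU Uab].
  by apply: continuous_comp; [exact: gc|exact: fc].
by rewrite -image_comp; apply: fo; apply: go.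
Qed.

Lemma small_connected_cover (e : R) : compact [set: X] -> locally_connected X -> 0 < e ->
  exists (V : X -> set X) (l : seq X),
    [/\ forall x, open (V x), forall x, connected (V x),
        forall x y z, V x y -> V x z -> mdist y z < e &
        forall y, exists2 x, x \in l & V x y].
Proof.
move=> cX lc e0.
have e20 : 0 < e / 2 by lin.
have [V hV] : {V : X -> set X & forall x,
    [/\ open (V x), connected (V x), V x x & V x `<=` ball x (e / 2)]}.
  apply: (choice (P := fun x (W : set X) =>
    [/\ open W, connected W, W x & W `<=` ball x (e / 2)])) => x.
  by apply: lc; exact: nbhsx_ballx.
(* [G] is the filter of properties eventually true of finite lists ordered by inclusion; the
   near-covering form of compactness then extracts a finite subcover. *)
pose G := [set S : set (seq X) | exists l0 : seq X, forall l, {subset l0 <= l} -> S l].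
have FG : Filter G.
  split=> [|S S' [l Sl] [l' Sl']|S S' SS' [l Sl]].
  - by exists [::].
  - exists (l ++ l') => k kl; split; [apply: Sl|apply: Sl'] => x xl; apply: kl;
    by rewrite mem_cat xl ?orbT.
  - by exists l => k /Sl /SS'.
pose P (l : seq X) (y : X) := exists2 x, x \in l & V x y.
have [|l /(_ l (fun _ => id)) hl] :=
    (compact_near_coveringP _).1 cX (seq X) G P FG.
  move=> x _; have [Vo _ Vx _] := hV x.
  exists (V x, [set l : seq X | x \in l]) => /=.
    split; first exact: open_nbhs_nbhs.
    by exists [:: x] => l; apply; rewrite mem_head.
  by move=> [y l] /= [Vy xl]; exists x.
exists V, l; split.
- by move=> x; have [] := hV x.
- by move=> x; have [] := hV x.
- move=> x y z xy xz; have [_ _ _ sub] := hV x.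
  move: (sub _ xy) (sub _ xz); rewrite ballEmdist/= => h1 h2.
  by have := metric_triangle y x z; rewrite (metric_sym y x); lin.
- by move=> y; exact: (hl y I).
Qed.

(** The last clause keeps the starting value outside [V], as the construction of first visits
    requires. *)
Definition sweeps F g a b (V : set X) : Prop :=
  exists f u v, [/\ F f, a < u, u < v, v < b &
    (f \o g) @` `]u, v[ = V /\ ~ V (f (g u))].

(** Points in one member of the cover are less than [c / 2] apart, while some image of the path has
    two points more than [c] apart. A point of it at distance [c / 2] from the first lies in a
    member containing neither, so the path crosses that member. *)
Lemma sensitive_sweeps F : compact [set: X] -> locally_connected X ->
  (forall f, F f -> continuous f) -> (forall f, F f -> open_map f) -> sensitive F ->
  exists (V : X -> set X) (l : seq X), forall g a b, a < b -> open_path g a b ->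
    exists2 x, x \in l & sweeps F g a b (V x).
Proof.
move=> cX lc Fc Fo [c c0 sens].
have [|V [l [Vo Vc Vd Vl]]] := @small_connected_cover (c / 2) cX lc; first by lin.
exists V, l => g a b ab gp.
have [||f Ff] := sens (g @` `]a, b[).
- by apply: (open_path_itv gp).
- by exists (g ((a + b) / 2)), ((a + b) / 2) => //=; rewrite in_itv/=; lin.
rewrite /diam => /ereal_sup_gt[_ [[y z] /= [[_ [s + <-] <-] [_ [t + <-] <-]] <-]].
rewrite lte_fin /= !in_itv/=.
wlog st : s t / s <= t.
  move=> H hs ht; have [st|ts] := leP s t; first exact: H.
  by rewrite metric_sym; apply: H => //; exact: ltW.
move=> hs ht cd; have gf := open_path_comp (Fc _ Ff) (Fo _ Ff) gp.
pose d r := mdist (f (g s)) (f (g r)).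
have dc : {within `[s, t], continuous d}.
  apply: continuous_in_subspaceT => r; rewrite inE/= in_itv/= => hr.
  apply: (@continuous_comp _ _ _ (f \o g)); last exact: continuous_mdist.
  by apply: gf.1; lin.
have ds : d s = 0 by rewrite /d mdistxx.
have [|r + dr] := @IVT R d s t (c / 2) st dc.
  rewrite ds ge_min le_max; apply/andP; split; apply/orP; [left|right]; first by lin.
  by rewrite /d; lin.
rewrite in_itv/= => hr.
have [x xl Vx] := Vl (f (g r)).
have Vs : ~ V x (f (g s)).
  by move=> Vs; have := Vd _ _ _ Vs Vx; move: dr; rewrite /d; lra.
have Vt : ~ V x (f (g t)).
  move=> Vt; have := Vd _ _ _ Vx Vt; move: dr; rewrite /d.
  by have := metric_triangle (f (g s)) (f (g r)) (f (g t)); lra.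
have sr : s != r by apply/eqP => E; apply: Vs; rewrite E.
have rt : r != t by apply/eqP => E; apply: Vt; rewrite -E.
exists x => //.
have [|||u [v [h1 h2 h3 h4 _]]] := open_path_component_connected (@metric_hausdorff _ _) gf
  _ _ _ (Vo x) (Vc x) Vx Vs Vt.
- by lin.
- by rewrite !lt_neqAle sr rt; lin.
- by lin.
by exists f, u, v; split => //; lin.
Qed.

(* Among all open paths, one that sweeps the fewest members of a suitable finite
   family sweeps the same ones along each of its images and subpaths. *)
Lemma recurrent_path F g0 a0 b0 (V : X -> set X) (l : seq X) :
  (forall f, F f -> continuous f) -> (forall f, F f -> open_map f) ->
  (forall f f', F f -> F f' -> F (f \o f')) ->
  (forall g a b, a < b -> open_path g a b -> exists2 x, x \in l & sweeps F g a b (V x)) ->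
  a0 < b0 -> open_path g0 a0 b0 ->
  exists g a b u v, [/\ open_path g a b, a < u < v, v < b,
    ~ (g @` `]u, v[) (g u) &
    forall a' b', u <= a' -> a' < b' -> b' <= v -> sweeps F g a' b' (g @` `]u, v[)].
Proof.
move=> Fc Fo FF sw ab0 gp0.
pose N g a b := count (fun x => `[< sweeps F g a b (V x) >]) l.
pose Q n := `[< exists g a b, [/\ a < b, open_path g a b & N g a b = n] >].
have exQ : exists n, Q n by exists (N g0 a0 b0); apply/asboolP; exists g0, a0, b0.
have [n /asboolP[g [a [b [ab gp Nn]]]] nmin] := ex_minnP exQ.
have [x xl [f [u [v [Ff au uv vb [fV fu]]]]]] := sw g a b ab gp.
have fgp := open_path_comp (Fc _ Ff) (Fo _ Ff) gp.
exists (f \o g), a, b, u, v; split => //.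
- by rewrite au.
- by rewrite fV.
move=> a' b' ua' ab' bv'; rewrite fV; apply: contrapT => nsw.
have fgp' : open_path (f \o g) a' b' by apply: open_path_sub fgp; lin.
have : (n <= N (f \o g) a' b')%N.
  by apply: nmin; apply/asboolP; exists (f \o g), a', b'.
rewrite leqNgt -Nn => /negP; apply.
(* Whatever [f \o g] sweeps on the subinterval by [h], [g] sweeps by [h \o f]; as [g] also sweeps
   [V x], the count would drop below the minimum. *)
apply: (@count_lt _ _ _ _ x) => //.
- move=> y /asboolP[h [u' [v' [Fh au' uv' vb' [hV hu]]]]]; apply/asboolP.
  by exists (h \o f), u', v'; split => //; [exact: FF|lin|lin].
- by apply/asboolP; exists f, u, v.
- by apply/asboolP.
Qed.

End sensitive_dynamics.

(** * Arc or circle from commuting sweeps *)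

Section commuting_sweeps.
Context {R : realType} {X : metricType R}.
Hypothesis cptX : compact [set: X].
Hypothesis conX : connected [set: X].
Hypothesis niso : forall x : X, ~ open [set x].
Implicit Types (g : R -> X) (a b s t u v : R).

Let hausX : hausdorff_space X := @metric_hausdorff R X.

(* [h] has a fixed point [g p] on the path, and moves [g v0] for suitable parameters
   [v0] at which some [k] in [F] takes the value [g p]; as [k] commutes with
   [h], it identifies [g v0] and [h (g v0)]. This makes [k \o g] fold or [X] a circle.
   Folds are then transported along the path by commutation. *)
Lemma commuting_sweeps_arc_or_circle (F : set (X -> X)) g a b u v :
  (forall f, F f -> continuous f) -> (forall f, F f -> open_map f) ->
  commutative_maps F -> open_path g a b -> a < u < v -> v < b ->
  ~ (g @` `]u, v[) (g u) ->
  (forall a' b', u <= a' -> a' < b' -> b' <= v -> sweeps F g a' b' (g @` `]u, v[)) ->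
  homeomorphic X (set_type (@unit_interval R)) \/
  homeomorphic X (set_type (@unit_circle R)).
Proof.
move=> Fc Fo comm gp /andP[au uv] vb gu sw.
have [r [rV rle rini rcont]] := first_visit hausX gp au uv vb gu.
set V := (g @` `]u, v[) in gu sw rV rcont.
have gV t : u < t < v -> V (g t) by move=> ht; exists t => //=; rewrite in_itv.
have [s1 hs1 rs1] : exists2 s1, u < s1 < v & r (g s1) = s1.
  have [|h1 h2] := rV (g ((u + v) / 2)); first by apply: gV; lin.
  by exists (r (g ((u + v) / 2))); rewrite ?h2.
have rS s : u < s <= s1 -> r (g s) = s by move=> hs; apply: (rini s s1) => //; lin.
(* Up to [s1] every parameter is a first visit, so [r] is a coordinate there. [h] will stretch a
   subpath within []A, B[] across [V], and [psi] is [h] read in this coordinate. *)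
pose A := u + (s1 - u) / 3; pose B := u + (s1 - u) / 3 * 2.
have hA : u < A by rewrite /A; lin.
have hAB : A < B by rewrite /A /B; lin.
have hB : B < s1 by rewrite /B; lin.
have [|||h [u' [v' [Fh Au' uv' vB' [hV _]]]]] := sw A B; [lin|lin|lin|].
clearbody A B.
pose psi t := r (h (g t)).
have hgV t : u' < t < v' -> V (h (g t)).
  by move=> ht; rewrite -hV; exists t => //=; rewrite in_itv.
have hgp := open_path_comp (Fc _ Fh) (Fo _ Fh) gp.
have psiC t : u' < t < v' -> {for t, continuous psi}.
  move=> ht; apply: (@continuous_comp _ _ _ (h \o g) r).
    by apply: hgp.1; lin.
  by apply: rcont; exact: hgV.
have reach s : u < s <= s1 -> exists2 t, u' < t < v' & psi t = s.
  move=> hs; have : V (g s) by apply: gV; lin.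
  rewrite -hV => -[t + ht]; rewrite /= in_itv/= => htt; exists t => //.
  by rewrite /psi -[h (g t)]/((h \o g) t) ht rS.
have [|t0 ht0 psit0] := reach ((u + A) / 2); first by lin.
have [|t1 ht1 psit1] := reach s1; first by lin.
(* [psi] is below [A] at [t0] and above [B] at [t1], so it crosses the diagonal. *)
have [p hp psip] : exists2 p, u' < p < v' & psi p = p.
  have key z w : u' < z -> z <= w -> w < v' ->
      Num.min (z - psi z) (w - psi w) <= 0 <= Num.max (z - psi z) (w - psi w) ->
      exists2 p, u' < p < v' & psi p = p.
    move=> uz zw wv hzw.
    have [|p + hp] := @IVT R (fun t => t - psi t) z w 0 zw _ hzw.
      apply: continuous_in_subspaceT => t; rewrite inE/= in_itv/= => ht.
      by apply: cvgB; [exact: cvg_id|apply: psiC; lin].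
    by rewrite in_itv/= => ht; exists p; lin.
  have [t01|t10] := leP t0 t1.
    apply: (key t0 t1) => //; [lin|lin|].
    by rewrite ge_min le_max; apply/andP; split; apply/orP; [right|left]; lin.
  apply: (key t1 t0); [lin|lin|lin|].
  by rewrite ge_min le_max; apply/andP; split; apply/orP; [left|right]; lin.
have hgp_fix : h (g p) = g p.
  have [|_ <-] := rV (h (g p)); first exact: hgV.
  by rewrite -/(psi p) psip.
(* Around [t0] the values of [psi] stay below [A], hence below the parameter: [h] moves these points
   back along the path. *)
have [d d0 hd] : exists2 d, 0 < d & forall t, t0 - d < t < t0 + d -> u' < t < v' /\ psi t < A.
  have : \forall t \near t0, u' < t < v' /\ psi t < A.
    near=> t; split.
      near: t; have : open (`]u', v'[%classic : set R) by exact: itv_open.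
      by move/(_ t0) => /=; rewrite in_itv/= => /(_ ht0).
    have : psi t < (u + A) / 2 + (A - u) / 4; last by lin.
    near: t; have /cvgrPdist_lt := psiC t0 ht0.
    move=> /(_ ((A - u) / 4)); rewrite psit0 => H.
    have /H : 0 < (A - u) / 4 by lin.
    by apply: filterS => t; rewrite ltr_norml; lra.
  move=> /nbhs_ballP[e/= e0 he]; exists e => // s ste; apply: he.
  by rewrite /ball/= ltr_distlC.
have [td1 td2] : u' <= t0 - d / 2 /\ t0 + d / 2 <= v'.
  have [|H1 _] := hd (t0 - d / 2); first by lin.
  have [|H2 _] := hd (t0 + d / 2); first by lin.
  by split; lin.
have [|||k [u2 [v2 [Fk hu2 uv2 hv2 [kV _]]]]] := sw (t0 - d / 2) (t0 + d / 2); [lin|lin|lin|].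
have [v0 hv0 kv0] : exists2 v0, u2 < v0 < v2 & k (g v0) = g p.
  have : V (g p) by apply: gV; lin.
  by rewrite -kV => -[t + <-]; rewrite /= in_itv/= => ht; exists t.
have [|hv0' psiv0] := hd v0; first by lin.
have [|v1b gv1] := rV (h (g v0)); first exact: hgV.
rewrite -/(psi v0) in v1b gv1.
have kgp := open_path_comp (Fc _ Fk) (Fo _ Fk) gp.
have kv1 : k (g (psi v0)) = k (g v0).
  rewrite gv1 kv0 -[LHS]/((k \o h) (g v0)) (comm _ _ Fk Fh) /=.
  by rewrite kv0.
have [li|] := pselect (forall c, psi v0 <= c <= v0 -> locally_injective_at (k \o g) c).
  right; apply: (loop_circle hausX cptX conX kgp _ _ _ kv1 li); lin.
move=> /existsNP[c /not_implyP[hc nli]].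
(* A sweep of a subpath preceding the fold [c] covers [g c], at some earlier parameter [c']. *)
have [|||q [u3 [v3 [Fq hu3 uv3 hv3 [qV _]]]]] := sw u c; [lin|lin|lin|].
have [c' hc' qc'] : exists2 c', u3 < c' < v3 & q (g c') = g c.
  have : V (g c) by apply: gV; lin.
  by rewrite -qV => -[t + <-]; rewrite /= in_itv/= => ht; exists t.
have qgp := open_path_comp (Fc _ Fq) (Fo _ Fq) gp.
have kqgp := open_path_comp (Fc _ Fk) (Fo _ Fk) qgp.
apply: (two_folds hausX cptX conX niso kqgp (p1 := c') (p2 := c)).
- by lin.
- by lin.
- by lin.
(* Parameters [s] and [t] near [c] lift through [q \o g] to parameters near [c']. Injectivity of
   [k \o q \o g] there gives [g s = g t], and [s = t] since both are first visits. *)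
- move=> [e e0 inj]; apply: nli.
  pose al := Num.max u3 (c' - e); pose be := Num.min v3 (c' + e).
  have [al1 al2 al3] : [/\ u3 <= al, c' - e <= al & al < c'].
    by split; rewrite /al ?gt_max ?le_max ?lexx ?orbT//; lin.
  have [be1 be2 be3] : [/\ be <= v3, be <= c' + e & c' < be].
    by split; rewrite /be ?lt_min ?ge_min ?lexx ?orbT//; lin.
  clearbody al be.
  have [|||e1 e10 he1] := @open_path_near _ _ g a b c ((q \o g) @` `]al, be[) gp.
  + by lin.
  + by apply: (open_path_itv qgp); lin.
  + by exists c' => //=; rewrite in_itv/=; lin.
  exists (Num.min e1 (Num.min (c - u) (s1 - c))).
    by rewrite !lt_min e10; lin.
  set e2 := Num.min _ _.
  have [m1 m2 m3] : [/\ e2 <= e1, e2 <= c - u & e2 <= s1 - c].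
    by split; rewrite /e2 !ge_min lexx ?orbT.
  clearbody e2.
  move=> s t hs ht /= kst.
  have [|_ [s' + qs']] := he1 s; first by lin.
  have [|_ [t' + qt']] := he1 t; first by lin.
  rewrite /= !in_itv/= => ht' hs'.
  have E : s' = t' by apply: inj; [lin|lin|rewrite /= in qs' qt' *; rewrite qs' qt'].
  have gst : g s = g t by rewrite -qs' -qt' E.
  by rewrite -(rS s) ?gst ?rS//; lin.
(* At [c] the map is read as [q \o k \o g], which inherits the coincidences of [k \o g]. *)
- move=> [e e0 inj]; apply: nli; exists e => // s t hs ht kst.
  apply: inj => //; rewrite -[LHS]/((k \o q) (g s)) -[RHS]/((k \o q) (g t)).
  by rewrite (comm _ _ Fk Fq) /=; congr q.
Unshelve. all: by end_near. Qed.

End commuting_sweeps.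

(** * The open path given by a free interval, and the conclusion *)

Lemma free_interval_path (R : realType) (X : metricType R) (J : set X) : free_open_interval J ->
  exists g : R -> X, open_path g 0 1.
Proof.
move=> [oJ [f [g [cf cg fK gK]]]].
have h2 : (2^-1 : R) \in @open_unit_interval R.
  by rewrite inE /open_unit_interval /= in_itv/=; lra.
pose I := @open_unit_interval R.
(* [x0] is the default value of the extended path outside []0, 1[]. *)
pose x0 : X := set_val (g (exist _ 2^-1 h2)).
pose gv (t : set_type I) : X := set_val (g t).
pose gam := 'valL_ x0 gv.
have gamE t : gam (set_val t) = set_val (g t).
  by have /(congr1 (fun k => k t)) := valLK x0 gv.
have oI : open I by exact: itv_open.
exists gam; split.
  have : {within I, continuous gam}.
    apply: (subspace_valL_continuousP' I x0 gv).2 => t.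
    apply: continuous_comp; first exact: cg.
    exact: initial_continuous.
  rewrite continuous_open_subspace// => c t ht; apply: c.
  by rewrite inE /I /open_unit_interval /= in_itv.
move=> U oU UI.
have oW : open (f @^-1` (set_val @^-1` U)).
  apply: open_comp; first by move=> ? _; exact: cf.
  by apply: open_comp => // ? _; exact: initial_continuous.
case: oW => W oW WE.
rewrite (_ : _ @` _ = J `&` W); first exact: openI.
apply/seteqP; split => [_ [t Ut <-]|x [Jx Wx]].
  have It : t \in I by rewrite inE; apply: UI.
  pose t' : set_type I := exist _ t It.
  have -> : t = set_val t' by [].
  rewrite gamE; split; first exact: set_valP.
  have : (set_val @^-1` W) (g t') by rewrite WE /= gK.
  by [].
have Jx' : x \in J by rewrite inE.
pose x' : set_type J := exist _ x Jx'.
have : (set_val @^-1` W) x' by [].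
rewrite WE /= => Uf; exists (set_val (f x')) => //.
by rewrite gamE fK.
Qed.

Theorem theorem1p1 (R : realType) (X : metricType R)
  (hX : peano_continuum X)
  (harc : exists A : set X, free_arc A)
  (hF : exists F : set (X -> X),
    [/\ subsemigroup_C0 F, commutative_maps F,
        forall f, F f -> open_map f & sensitive F]) :
  is_arc X \/ is_circle X.
Proof.
have [[cptX conX] lcX] := hX.
have [F [[FC FF] comm Fo sens]] := hF.
have Fc f : F f -> continuous f by exact: FC.
have [_ [J [fJ _ _]]] := harc.
have [g0 gp0] := free_interval_path fJ.
(* An isolated point would be open and closed, hence all of [X], and no image could have positive
   diameter. *)
have niso (x : X) : ~ open [set x].
  move=> ox; have [c c0 cU] := sens.
  have [||f _] := cU setT; [exact: openT|by exists x|].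
  move=> /ereal_sup_gt[_ [[y z] /= _ <-]]; rewrite lte_fin/= => cyz.
  have cx : closed [set x].
    by apply: accessible_closed_set1; apply: hausdorff_accessible; exact: metric_hausdorff.
  have all w : w = x by apply: (clopen_setT conX ox cx _ w); exists x.
  by move: cyz; rewrite (all y) (all z) mdistxx; lra.
have [V [l sw]] := sensitive_sweeps cptX lcX Fc Fo sens.
have [g [a [b [u [v [gp auv vb gu rec]]]]]] := recurrent_path Fc Fo FF sw ltr01 gp0.
have [?|?] := commuting_sweeps_arc_or_circle cptX conX niso Fc Fo comm gp auv vb gu rec.
- by left.
- by right.
Qed.
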